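(* Let $\mathtt{L}$ be a functional language and $\mathcal{B}$ an $\mathtt{L}$-algebra. Then there exists an elementary extension $\mathcal{B}^\ast$ of $\mathcal{B}$ such that $\mathcal{B}^\ast$ is $\mathrm{u}_\omega$-compact (in particular, $\mathcal{B}^\ast$ is $\mathrm{q}_\omega$-compact).
   Context: A functional language $\mathtt{L}$ is a first-order language with function and constant symbols only (and equality); $\mathtt{L}$-structures are called $\mathtt{L}$-algebras. For a finite set of variables $X=\{x_1,\dots,x_n\}$, $\mathrm{At}_{\mathtt{L}}(X)$ is the set of atomic formulas $(t=s)$ of $\mathtt{L}$ in variables $X$ (equations), and for $S\subseteq\mathrm{At}_{\mathtt{L}}(X)$, $\mathrm{V}_{\mathcal{B}}(S)\subseteq B^n$ is the set of solutions of $S$ in $\mathcal{B}$. An $\mathtt{L}$-algebra $\mathcal{B}$ is $\mathrm{u}_\omega$-compact if for any finite $X$, any $S\subseteq\mathrm{At}_{\mathtt{L}}(X)$ and any equations $(t_1=s_1),\dots,(t_m=s_m)\in\mathrm{At}_{\mathtt{L}}(X)$ with $\mathrm{V}_{\mathcal{B}}(S)\subseteq \mathrm{V}_{\mathcal{B}}(t_1=s_1)\cup\dots\cup\mathrm{V}_{\mathcal{B}}(t_m=s_m)$ there is a finite $S_0\subseteq S$ with $\mathrm{V}_{\mathcal{B}}(S_0)\subseteq \mathrm{V}_{\mathcal{B}}(t_1=s_1)\cup\dots\cup\mathrm{V}_{\mathcal{B}}(t_m=s_m)$. It is $\mathrm{q}_\omega$-compact if for any finite $X$, any $S\subseteq\mathrm{At}_{\mathtt{L}}(X)$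 and any equation $(t_0=s_0)\in\mathrm{At}_{\mathtt{L}}(X)$ with $\mathrm{V}_{\mathcal{B}}(S)\subseteq\mathrm{V}_{\mathcal{B}}(t_0=s_0)$ there is a finite $S_0\subseteq S$ with $\mathrm{V}_{\mathcal{B}}(S_0)\subseteq\mathrm{V}_{\mathcal{B}}(t_0=s_0)$. *)

(* Defs.v *)
From mathcomp Require Import all_boot all_classical.

Set Implicit Arguments.
Unset Strict Implicit.
Unset Printing Implicit Defensive.

Local Open Scope classical_set_scope.

(* Constant symbols are the symbols of arity 0. *)
Record language : Type := Language {
  symbol : Type;
  arity : symbol -> nat
}.

(* As usual in model theory, structures are nonempty. *)
Record algebra (L : language) : Type := Algebra {
  carrier :> Type;
  carrier_inhabited : inhabited carrier;
  interp : forall f : symbol L, ('I_(arity f) -> carrier) -> carrier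
}.

Inductive term (L : language) (X : Type) : Type :=
| Var of X
| App (f : symbol L) of ('I_(arity f) -> term L X).

Fixpoint eval (L : language) (X : Type) (B : algebra L) (v : X -> B)
    (t : term L X) : B :=
  match t with
  | Var x => v x
  | App f ts => interp (fun i => eval v (ts i))
  end.

(* The pair (t, s) stands for the atomic formula (t = s); At_L(x_1, ..., x_n)
   is [equation L 'I_n]. *)
Definition equation (L : language) (X : Type) : Type :=
  (term L X * term L X)%type.

Definition satisfies_eq (L : language) (X : Type) (B : algebra L) (v : X -> B)
    (e : equation L X) : Prop :=
  eval v e.1 = eval v e.2.

(* First-order formulas, with variables named by natural numbers. *)
Inductive formula (L : language) : Type :=
| FAtom of equation L nat
| FNot of formula L
| FAnd of formula L & formula L
| FOr of formula L & formula L
| FImp of formula L & formula L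
| FAll of nat & formula L
| FEx of nat & formula L.

Definition update (T : Type) (v : nat -> T) (k : nat) (b : T) : nat -> T :=
  fun j => if j == k then b else v j.

Fixpoint satisfies (L : language) (B : algebra L) (v : nat -> B)
    (phi : formula L) : Prop :=
  match phi with
  | FAtom e => satisfies_eq v e
  | FNot p => ~ satisfies v p
  | FAnd p q => satisfies v p /\ satisfies v q
  | FOr p q => satisfies v p \/ satisfies v q
  | FImp p q => satisfies v p -> satisfies v q
  | FAll k p => forall b : B, satisfies (update v k b) p
  | FEx k p => exists b : B, satisfies (update v k b) p
  end.

Definition elementary_embedding (L : language) (B C : algebra L)
    (h : B -> C) : Prop :=
  forall (phi : formula L) (v : nat -> B),
    satisfies v phi <-> satisfies (fun k => h (v k)) phi.

(* B is identified with its image in C. An elementary embedding is in particular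
   injective and commutes with the operations, by the atomic formulas x_0 = x_1
   and f(x_1, ..., x_k) = x_0. *)
Definition elementary_extension (L : language) (B C : algebra L) : Prop :=
  exists h : B -> C, elementary_embedding h.

Definition solutions (L : language) (B : algebra L) (n : nat)
    (S : set (equation L 'I_n)) : set ('I_n -> B) :=
  [set p | forall e, S e -> satisfies_eq p e].

Arguments solutions {L} B {n} S _.

(* The union over m = 0 equations is empty; on nonempty algebras this case follows
   from the others, by adjoining two fresh variables y, z and the equation
   y = z. *)
Definition u_omega_compact (L : language) (B : algebra L) : Prop :=
  forall (n : nat) (S : set (equation L 'I_n))
         (m : nat) (e : 'I_m -> equation L 'I_n),
    solutions B S `<=` \bigcup_i solutions B [set e i] ->
    exists S0 : set (equation L 'I_n),
      [/\ finite_set S0, S0 `<=` S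
        & solutions B S0 `<=` \bigcup_i solutions B [set e i]].

Definition q_omega_compact (L : language) (B : algebra L) : Prop :=
  forall (n : nat) (S : set (equation L 'I_n)) (e0 : equation L 'I_n),
    solutions B S `<=` solutions B [set e0] ->
    exists S0 : set (equation L 'I_n),
      [/\ finite_set S0, S0 `<=` S
        & solutions B S0 `<=` solutions B [set e0]].

(* Main.v *)
(** The types to be realised -- a set of equations in finitely many variables
    together with finitely many inequations -- have no parameters.  Hence, by
    Los's theorem, a type finitely satisfiable in an ultrapower of [B] is
    already finitely satisfiable in [B], and a single ultrapower suffices.  Its
    index set consists of the finite sets [i] of equations and its ultrafilter
    contains all the cones [{i | A `<=` i}]: choosing at each [i] a solution
    in [B] of the part of the type lying in [i] gives a solution of the whole
    type in the ultrapower. *)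
Require Import Defs.
From mathcomp Require Import all_boot all_classical.

Set Implicit Arguments.
Unset Strict Implicit.
Unset Printing Implicit Defensive.

Local Open Scope classical_set_scope.

Lemma filter_forall_finite (T J : Type) (F : set_system T) (D : set J)
    (P : J -> set T) : Filter F -> finite_set D ->
  (forall j, D j -> F (P j)) -> F [set x | forall j, D j -> P j x].
Proof.
move=> FF /(finite_fsetP (T := {classic J}))[X ->] FP.
exact: (filter_bigI (I := {classic J})).
Qed.

(** * Ultrapowers and Los's theorem *)

Section Ultrapower.
Context (L : language) (B : algebra L) (I : Type) (U : set_system I).
Context {UU : UltraFilter U}.

Lemma ultra_not (A : set I) : U (~` A) <-> ~ U A.
Proof.
split=> [UnA UA|nUA]; last by case: (in_ultra_setVsetC A UU).
by have [i []] := filter_ex (filterI UA UnA).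
Qed.

Lemma ultra_or (A1 A2 : set I) : U (A1 `|` A2) <-> U A1 \/ U A2.
Proof.
split=> [UA|[]]; [|by apply: filterS => i; left|by apply: filterS => i; right].
have [UA1|/ultra_not UnA1] := pselect (U A1); first by left.
by right; apply: filterS (filterI UA UnA1) => i [[]].
Qed.

Lemma ultra_and (A1 A2 : set I) : U (A1 `&` A2) <-> U A1 /\ U A2.
Proof.
split=> [UA|[]]; last exact: filterI.
by split; apply: filterS UA => i [].
Qed.

Lemma ultra_imp (A1 A2 : set I) :
  U [set i | A1 i -> A2 i] <-> (U A1 -> U A2).
Proof.
split=> [|UA]; first exact: filter_app.
have [/UA UA2|/ultra_not UnA1] := pselect (U A1).
  by apply: filterS UA2 => i A2i _.
by apply: filterS UnA1 => i nA1 /nA1.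
Qed.

Definition ultra_class (f : I -> B) : set (I -> B) :=
  [set g | U [set i | g i = f i]].

(** The quotient of [I -> B] by equality on a set of [U], encoded as its set of classes. *)
Definition ultrapower_carrier := {A : set (I -> B) | range ultra_class A}.

Definition to_ultrapower (f : I -> B) : ultrapower_carrier :=
  exist _ (ultra_class f) (ex_intro2 _ _ f Logic.I erefl).

Lemma to_ultrapowerP (f g : I -> B) :
  to_ultrapower f = to_ultrapower g <-> U [set i | f i = g i].
Proof.
split=> [/(congr1 sval)/= fg|Ufg].
  by change (ultra_class g f); rewrite -fg; apply: filterE.
apply: eq_exist; rewrite /= eqEsubset; split=> h; rewrite /ultra_class /= => Uh.
  by apply: filterS2 Uh Ufg => i /= -> ->.
by apply: filterS2 Uh Ufg => i /= -> ->.
Qed.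

Lemma to_ultrapower_surj (a : ultrapower_carrier) :
  exists f, to_ultrapower f = a.
Proof. by case: a => A [f ? fA]; exists f; apply: eq_exist. Qed.

Lemma to_ultrapower_surj_fun (X : Type) (v : X -> ultrapower_carrier) :
  exists w : X -> I -> B, v = fun x => to_ultrapower (w x).
Proof.
have [w wP] := choice (fun x => to_ultrapower_surj (v x)).
by exists w; apply/funext => x; rewrite wP.
Qed.

(** The operations use these chosen representatives; [eval_ultrapower] shows that any others give
    the same values. *)
Definition ultrapower_repr (a : ultrapower_carrier) : I -> B :=
  sval (cid (to_ultrapower_surj a)).

Lemma ultrapower_reprK (a : ultrapower_carrier) :
  to_ultrapower (ultrapower_repr a) = a.
Proof. exact: (svalP (cid (to_ultrapower_surj a))). Qed.

Lemma ultrapower_inhabited : inhabited ultrapower_carrier.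
Proof.
by case: (carrier_inhabited B) => b; exact: inhabits (to_ultrapower (fun=> b)).
Qed.

Definition ultrapower : algebra L := {|
  carrier := ultrapower_carrier;
  carrier_inhabited := ultrapower_inhabited;
  interp := fun f a =>
    to_ultrapower (fun i => interp (fun j => ultrapower_repr (a j) i))
|}.

Lemma eval_ultrapower (X : Type) (v : X -> I -> B) (t : term L X) :
  eval (B := ultrapower) (fun x => to_ultrapower (v x)) t =
  to_ultrapower (fun i => eval (fun x => v x i) t).
Proof.
elim: t => [//|f ts IH] /=; apply/to_ultrapowerP.
suff : U [set i | forall j, ultrapower_repr
    (to_ultrapower (fun i => eval (fun x => v x i) (ts j))) i =
    eval (fun x => v x i) (ts j)].
  apply: filterS => i Hi /=; congr interp; apply/funext => j.
  by rewrite IH Hi.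
(* Arities are finite, so finitely many sets of [U] are intersected here. *)
apply: filter_forall => j; apply/to_ultrapowerP; exact: ultrapower_reprK.
Qed.

Lemma satisfies_eq_ultrapower (X : Type) (v : X -> I -> B)
    (e : equation L X) :
  satisfies_eq (B := ultrapower) (fun x => to_ultrapower (v x)) e <->
  U [set i | satisfies_eq (fun x => v x i) e].
Proof. by rewrite /satisfies_eq !eval_ultrapower to_ultrapowerP. Qed.

Lemma update_to_ultrapower (v : nat -> I -> B) k (b : I -> B) :
  update (fun x => to_ultrapower (v x)) k (to_ultrapower b) =
  fun x => to_ultrapower (update v k b x).
Proof. by apply/funext => x; rewrite /update; case: ifP. Qed.

Lemma update_eval (v : nat -> I -> B) k (b : I -> B) i :
  (fun x => update v k b x i) = update (fun x => v x i) k (b i).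
Proof. by apply/funext => x; rewrite /update; case: ifP. Qed.

Lemma ultra_ex (P : I -> B -> Prop) :
  U [set i | exists b, P i b] <-> exists b : I -> B, U [set i | P i (b i)].
Proof.
split=> [UP|[b]]; last by apply: filterS => i; exists (b i).
(* [b0] is the default value at indices without a witness. *)
case: (carrier_inhabited B) => b0.
have /choice[b bP] i : exists b, (exists b', P i b') -> P i b.
  by have [[b Pb]|] := pselect (exists b, P i b); [exists b|exists b0].
by exists b; apply: filterS UP => i /bP.
Qed.

(** Dual to [ultra_ex]: if the left side fails, pointwise counterexamples assemble into a single
    function [b]. *)
Lemma ultra_all (P : I -> B -> Prop) :
  U [set i | forall b, P i b] <-> forall b : I -> B, U [set i | P i (b i)].
Proof.
split=> [UP b|UP]; first by apply: filterS UP => i; apply.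
apply: contrapT => /ultra_not UnP.
have /ultra_ex[b] : U [set i | exists b, ~ P i b].
  by apply: filterS UnP => i /existsNP.
by move=> /ultra_not; apply; exact: UP.
Qed.

Theorem Los (phi : formula L) (v : nat -> I -> B) :
  satisfies (B := ultrapower) (fun x => to_ultrapower (v x)) phi <->
  U [set i | satisfies (fun x => v x i) phi].
Proof.
(* Shared by both quantifier cases: updating a valuation commutes with taking classes and with
   taking coordinates. *)
have updateP k p (w : nat -> I -> B) (b : I -> B) :
    (forall v : nat -> I -> B,
      satisfies (B := ultrapower) (fun x => to_ultrapower (v x)) p <->
      U [set i | satisfies (fun x => v x i) p]) ->
    satisfies (B := ultrapower)
      (update (fun x => to_ultrapower (w x)) k (to_ultrapower b)) p <->
    U [set i | satisfies (update (fun x => w x i) k (b i)) p].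
  move=> IH; rewrite update_to_ultrapower IH.
  by split; apply: filterS => i; rewrite /= update_eval.
elim: phi v => [e|p IH|p IHp q IHq|p IHp q IHq|p IHp q IHq|k p IH|k p IH] v /=.
- exact: satisfies_eq_ultrapower.
- by rewrite IH -ultra_not.
- by rewrite IHp IHq -ultra_and.
- by rewrite IHp IHq -ultra_or.
- by rewrite IHp IHq -ultra_imp.
- rewrite ultra_all; split=> [H b|H a]; first exact/updateP.
  by have [b <-] := to_ultrapower_surj a; apply/updateP.
- rewrite ultra_ex; split=> [[a]|[b Hb]].
    by have [b <-] := to_ultrapower_surj a => /updateP-/(_ IH) Hb; exists b.
  by exists (to_ultrapower b); apply/updateP.
Qed.

(** For constant functions the set in [Los] is everything or empty, and sets of [U] are nonempty. *)
Lemma ultrapower_elementary : elementary_extension B ultrapower.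
Proof.
exists (fun b => to_ultrapower (fun=> b)) => phi v; rewrite Los.
split=> [Bv|UBv]; first exact: filterE.
by have [] := filter_ex UBv.
Qed.

(** A counterexample in the ultrapower satisfies finitely many equations and inequations, so some
    coordinate of it is a counterexample in [B]. *)
Lemma solutions_ultrapower_descend (n : nat) (S0 : set (equation L 'I_n))
    (m : nat) (e : 'I_m -> equation L 'I_n) :
  finite_set S0 ->
  solutions B S0 `<=` \bigcup_i solutions B [set e i] ->
  solutions ultrapower S0 `<=` \bigcup_i solutions ultrapower [set e i].
Proof.
move=> fS0 S0e p; have [v ->] := to_ultrapower_surj_fun p => S0p.
apply: contrapT => enp.
have US0 : U [set i | solutions B S0 (fun x => v x i)].
  apply: filter_forall_finite => // e' /S0p.
  exact: (satisfies_eq_ultrapower _ _).1.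
have Ue : U [set i | forall j, ~ satisfies_eq (fun x => v x i) (e j)].
  apply: filter_forall => j; apply/ultra_not => /satisfies_eq_ultrapower ej.
  by apply: enp; exists j => // _ ->.
have [i [/S0e[j _ ej] ei]] := filter_ex (filterI US0 Ue).
by apply: (ei j); apply: ej.
Qed.

End Ultrapower.

(** * Compactness of the ultrapower over finite sets of equations *)

Section CompactUltrapower.
Context (L : language) (B : algebra L).

(** Equations are tagged with their number of variables, so that one index set serves every [n]. *)
Local Notation equations := (set {n & equation L 'I_n}).

Definition finite_equations := {A : equations | finite_set A}.

Definition cone (A : equations) : set finite_equations :=
  [set i | A `<=` sval i].

(** The cone of a union lies in both cones, and a finite [A] belongs to its own cone. *)
Lemma cone_filter : ProperFilter (filter_from finite_set cone).
Proof.
apply: filter_from_proper => [|A fA]; last by exists (exist _ A fA).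
apply: filter_from_filter => [|A1 A2 f1 f2]; first by exists set0.
exists (A1 `|` A2); first by rewrite finite_setU.
by move=> i A12; split=> x xA; apply: A12; [left|right].
Qed.

Lemma finite_slice n (A : equations) :
  finite_set A -> finite_set [set e : equation L 'I_n | A (existT _ n e)].
Proof.
by apply: finite_preimage => e e' _ _ ee'; exact: eq_from_Tagged ee'.
Qed.

Lemma ultrapower_u_omega_compact (U : set_system finite_equations)
    (UU : UltraFilter U) :
  filter_from finite_set cone `<=` U -> u_omega_compact (ultrapower B U).
Proof.
move=> coneU n S m e Se; apply: contrapT => noS0.
pose part (i : finite_equations) := S `&` [set e | sval i (existT _ n e)].
have fpart i : finite_set (part i).
  exact/finite_setIr/finite_slice/(svalP i).
(* Otherwise the finite set [part i] would satisfy the inclusion in [B], hence in the ultrapower,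
   against [noS0]. *)
have /choice[p pP] i : exists p : 'I_n -> B,
    solutions B (part i) p /\ forall j, ~ satisfies_eq p (e j).
  apply: contrapT => nop; apply: noS0; exists (part i); split=> //.
    exact: subIsetl.
  apply: solutions_ultrapower_descend => // p Sp.
  apply: contrapT => enp; apply: nop; exists p; split=> // j ej.
  by apply: enp; exists j => // _ ->.
(* The class of [p] solves each [e'] in [S], since [e'] lies in [part i] for all [i] in the cone of
   [e']. Hence it solves some [e j], which fails at every index. *)
have [|j _ /(_ _ erefl)] := Se (fun x => to_ultrapower U (fun i => p i x)).
  move=> e' Se'; apply/satisfies_eq_ultrapower.
  apply: coneU; exists [set existT _ n e'] => // i ie'.
  by have [Sp _] := pP i; apply: Sp; split=> //; apply: ie'.
move=> /satisfies_eq_ultrapower ej.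
by have [i] := filter_ex ej; have [_] := pP i; apply.
Qed.

End CompactUltrapower.

Lemma u_omega_q_omega_compact (L : language) (B : algebra L) :
  u_omega_compact B -> q_omega_compact B.
Proof.
move=> uB n S e0 Se0.
have union1 : \bigcup_(_ in [set: 'I_1]) solutions B [set e0] =
    solutions B [set e0].
  by rewrite bigcup_const //; exists ord0.
by have := uB n S 1 (fun=> e0); rewrite union1; apply.
Qed.

Theorem theorem7p4 (L : language) (B : algebra L) :
  exists Bstar : algebra L,
    elementary_extension B Bstar /\
    u_omega_compact Bstar /\
    q_omega_compact Bstar.
Proof.
(* The ultrafilter depends on [L] alone, not on [B]. *)
have [U [UU coneU]] := ultraFilterLemma (cone_filter L).
have uU := ultrapower_u_omega_compact (B := B) UU coneU.
exists (ultrapower B U); split; first exact: ultrapower_elementary.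
by split=> //; exact: u_omega_q_omega_compact.
Qed.
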